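(* Let $g$ solve system (S3) with initial data $h_{ii}>0$, $h_{11}\le h_{22}\le h_{33}$, and suppose $h\in D_\infty$, i.e. along the solution of the planar system (P) starting at $(h_{00}^{1/3}h_{22},h_{00}^{1/3}h_{33})$ one has $b,c\to\infty$. Then the solution of (S3) exists for all $t\ge0$ and as $t\to\infty$: $g_{00}\to0$, $g_{11}\to 0$, $g_{22},g_{33}\to\infty$, and $g_{33}-g_{22}\to0$.
   Context: Let $\det h = h_{00}h_{11}h_{22}h_{33}$, $\beta=\frac{1}{6(\det h)^2}$, $p(x,y,z) = x^4 - x^3(y+z) + x^2yz + x(-y^3+y^2z+yz^2-z^3) + y^4 - y^3z - yz^3 + z^4$, $q(x,y,z) = 5x^4 - 3x^3(y+z) + x^2yz + x(y^3-y^2z-yz^2+z^3) - 3y^4 + 3y^3z + 3yz^3 - 3z^4$, $r(x,y,z) = \tfrac12(p+3q)(x,y,z) = 8x^4-5x^3(y+z)+2x^2yz+x(y^3-y^2z-yz^2+z^3)-4y^4+4y^3z+4yz^3-4z^4$. System (S3): $\dot g_{00} = -\beta\,p(g_{11},g_{22},g_{33})\,g_{00}^3$, $\dot g_{11} = -\beta\,q(g_{11},g_{22},g_{33})\,g_{00}^2g_{11}$, $\dot g_{22} = -\beta\,q(g_{22},g_{33},g_{11})\,g_{00}^2g_{22}$, $\dot g_{33} = -\beta\,q(g_{33},g_{11},g_{22})\,g_{00}^2g_{33}$, $g_{ii}(0)=h_{ii}$ (Bach flow on $\mathbb{R}\times\mathbb{S}^3$ in a diagonalizing frame; $g_{00}g_{11}g_{22}g_{33}=\det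 h$ is preserved). Set $a=g_{00}^{1/3}g_{11}$, $b=g_{00}^{1/3}g_{22}$, $c=g_{00}^{1/3}g_{33}$, so $abc=\det h$. Under (S3), $(b,c)$ follows, up to a time reparametrization, the planar system (P): $\dot b=-\tfrac23 r(b,a,c)\,b$, $\dot c=-\tfrac23 r(c,a,b)\,c$ with $a=\det h/(bc)$, on the region $a\le b\le c$. $D_\infty$ denotes the set of initial metrics whose (P)-trajectory has $b,c\to\infty$. *)

(* Defs.v *)
From Stdlib Require Import Reals Lra.
Open Scope R_scope.

Definition pP (x y z : R) : R :=
  x^4 - x^3*(y+z) + x^2*y*z + x*(-y^3 + y^2*z + y*z^2 - z^3)
  + y^4 - y^3*z - y*z^3 + z^4.

Definition qP (x y z : R) : R :=
  5*x^4 - 3*x^3*(y+z) + x^2*y*z + x*(y^3 - y^2*z - y*z^2 + z^3)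
  - 3*y^4 + 3*y^3*z + 3*y*z^3 - 3*z^4.

Definition rP (x y z : R) : R :=
  8*x^4 - 5*x^3*(y+z) + 2*x^2*y*z + x*(y^3 - y^2*z - y*z^2 + z^3)
  - 4*y^4 + 4*y^3*z + 4*y*z^3 - 4*z^4.

Definition deth (h0 h1 h2 h3 : R) : R := h0 * h1 * h2 * h3.
Definition betaC (h0 h1 h2 h3 : R) : R := 1 / (6 * (deth h0 h1 h2 h3)^2).

Definition S3_global_solution (h0 h1 h2 h3 : R) (g0 g1 g2 g3 : R -> R) : Prop :=
  g0 0 = h0 /\ g1 0 = h1 /\ g2 0 = h2 /\ g3 0 = h3 /\
  forall t, 0 <= t ->
    derivable_pt_lim g0 t
      (- betaC h0 h1 h2 h3 * pP (g1 t) (g2 t) (g3 t) * (g0 t)^3) /\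
    derivable_pt_lim g1 t
      (- betaC h0 h1 h2 h3 * qP (g1 t) (g2 t) (g3 t) * (g0 t)^2 * g1 t) /\
    derivable_pt_lim g2 t
      (- betaC h0 h1 h2 h3 * qP (g2 t) (g3 t) (g1 t) * (g0 t)^2 * g2 t) /\
    derivable_pt_lim g3 t
      (- betaC h0 h1 h2 h3 * qP (g3 t) (g1 t) (g2 t) * (g0 t)^2 * g3 t).

Definition in_dom (T : option R) (t : R) : Prop :=
  0 <= t /\ match T with None => True | Some T' => t < T' end.

Definition to_infty_at (T : option R) (f : R -> R) : Prop :=
  forall M : R, exists t0, in_dom T t0 /\
    forall t, t0 <= t -> in_dom T t -> M < f t.

(* (b,c) solves the planar system (P) on [0,T), with a = det h/(b c). *)
Definition P_solution (dh : R) (T : option R) (b c : R -> R) : Prop :=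
  forall t, in_dom T t ->
    0 < b t /\ 0 < c t /\
    derivable_pt_lim b t (- (2/3) * rP (b t) (dh / (b t * c t)) (c t) * b t) /\
    derivable_pt_lim c t (- (2/3) * rP (c t) (dh / (b t * c t)) (b t) * c t).

Definition in_D_infty (h0 h1 h2 h3 : R) : Prop :=
  exists (T : option R) (b c : R -> R),
    b 0 = Rpower h0 (1/3) * h2 /\ c 0 = Rpower h0 (1/3) * h3 /\
    P_solution (deth h0 h1 h2 h3) T b c /\
    to_infty_at T b /\ to_infty_at T c.

Definition tends_to (f : R -> R) (l : R) : Prop :=
  forall eps, 0 < eps -> exists T, forall t, T <= t -> Rabs (f t - l) < eps.

Definition tends_to_infty (f : R -> R) : Prop := to_infty_at None f.

(* Main.v *)
(** Along (P) the gap [w = c - b] satisfies [w' = -(2/3) kappa w], where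
    [kappa >= 8 c^4] once [a] is small against [b], while [(ln b)'] is at most
    [(2/3) a^2 b^2] plus a multiple of [c^3 w].  So [ln b + 20 w] has derivative
    at most [(2/3) a^2 b^2], which is bounded, and [b] cannot blow up in finite
    time.  Let [s = g00^(1/3)], so [s' = -(1/3) p s] in the time of (P),
    [g11 = a/s], [g22 = b/s], [g33 = c/s], and the time of (S3) is the integral
    of [1 / (beta s^2)], which diverges because [p >= 0] makes [s] decrease.
    Both [p] and [q(a,b,c)] dominate a multiple of [a^2 b^2] up to terms in
    [c^3 w], so adding a small multiple of [ln b + 20 w] to [ln s] or [ln (a/s)]
    gives a nonincreasing function; as [b] tends to infinity, [s] and [a/s]
    tend to [0].  Finally [w/s] decays at least like [exp (-t)]. *)

Require Import Defs.
From Stdlib Require Import Reals Lra Psatz.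
From Coquelicot Require Import Coquelicot.
Open Scope R_scope.

(** * The gap polynomial and quartic inequalities for elongated triples *)

Definition kappaP (a b c : R) : R :=
  8*c^4 + 7*c^3*b + 6*c^2*b^2 + 7*c*b^3 + 8*b^4
  - a*(c+b)*(5*c^2 + 5*b^2 + 2*b*c) - a^2*b*c + a^3*(b+c) - 4*a^4.

(** Swapping [b] and [c] changes the sign of the left side, so [c - b] divides it, and [kappaP] is
    the quotient. Hence the gap [c - b] satisfies a homogeneous linear equation along (P). *)
Lemma rP_difference (a b c : R) :
  rP c a b * c - rP b a c * b = (c - b) * kappaP a b c.
Proof. unfold rP, kappaP; ring. Qed.

(* Schur's inequality of degree 4, through its sum-of-squares form. *)
Lemma pP_nonneg (a b c : R) : 0 <= pP a b c.
Proof.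
  replace (pP a b c) with
    (1/2 * (((b-c)*(b+c-a))^2 + ((c-a)*(c+a-b))^2 + ((a-b)*(a+b-c))^2))
    by (unfold pP; field).
  assert (H1 := pow2_ge_0 ((b-c)*(b+c-a))).
  assert (H2 := pow2_ge_0 ((c-a)*(c+a-b))).
  assert (H3 := pow2_ge_0 ((a-b)*(a+b-c))).
  lra.
Qed.

Ltac nonneg_coefficients :=
  ring_simplify;
  repeat (apply Rplus_le_le_0_compat);
  repeat (apply Rmult_le_pos);
  repeat (apply pow_le); lra.

(** The factor 10 makes [a] small enough for the inequalities below; [1 <= c] serves later to bound
    [c^3] and constants by [c^4]. *)
Definition elongated (a b c : R) : Prop :=
  0 < a /\ 10 * a <= b /\ b <= c /\ 1 <= c.

(* After substituting [b = 10 a + x] and [c = b + w] with [x, w >= 0], every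
   difference below is a polynomial with nonnegative coefficients. *)
Ltac by_shifted_coefficients a b c :=
  let Ha := fresh in let Hb := fresh in let Hc := fresh in
  intros (Ha & Hb & Hc & _);
  apply Rminus_le_0;
  let x := fresh "x" in let w := fresh "w" in
  let Hx := fresh in let Hw := fresh in
  assert (Hx : 0 <= b - 10 * a) by lra;
  assert (Hw : 0 <= c - b) by lra;
  remember (b - 10 * a) as x eqn:Ex;
  remember (c - b) as w eqn:Ew;
  assert (c = 10 * a + x + w) by lra; subst c;
  assert (b = 10 * a + x) by lra; subst b;
  clear Ex Ew Hb Hc;
  unfold pP, qP, rP, kappaP; nonneg_coefficients.

Lemma kappaP_ge (a b c : R) : elongated a b c -> 8 * c^4 <= kappaP a b c.
Proof. by_shifted_coefficients a b c. Qed.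

(** For [b = c] the polynomial is [a^2 (b - a)^2], which is at least [(81/100) a^2 b^2] when
    [b >= 10 a]. *)
Lemma pP_ge (a b c : R) : elongated a b c -> a^2 * b^2 <= 2 * pP a b c.
Proof. by_shifted_coefficients a b c. Qed.

(** The constant is chosen against [kappaP_ge]: the decay rate [(1/3) p] of [s] is then at most half
    the decay rate [(2/3) kappa] of the gap. *)
Lemma pP_le (a b c : R) : elongated a b c -> pP a b c <= 8 * c^4.
Proof. by_shifted_coefficients a b c. Qed.

(** For [b = c] the terms [b^4] and [a b^3] cancel, leaving [- a^2 b^2 + 5 a^3 b - 4 a^4], where the
    last two terms have a nonnegative sum. What remains is divisible by [c - b] and is charged to
    [c^3 (c - b)]. *)
Lemma rP_ge (a b c : R) :
  elongated a b c -> - (a^2 * b^2 + 20 * c^3 * (c - b)) <= rP b a c.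
Proof. by_shifted_coefficients a b c. Qed.

(** For [b = c] the polynomial is [a^2 (b - a)(b - 5 a)], at least [(9/20) a^2 b^2] when
    [b >= 10 a]; this leaves room for the factor [2/5]. *)
Lemma qP_ge (a b c : R) :
  elongated a b c -> 2 * a^2 * b^2 - 100 * c^3 * (c - b) <= 5 * qP a b c.
Proof. by_shifted_coefficients a b c. Qed.

(** * Calculus tools: derivatives, monotonicity, primitives, extension of functions *)

Ltac derive_with :=
  repeat match goal with
  | H : is_derive ?f ?x ?l |- context [Derive (fun y => ?f y) ?x] =>
      replace (Derive (fun y => f y) x) with l
        by (symmetry; apply (is_derive_unique f x l H))
  end.

(** Derivatives of abstract functions must stand in the context as [is_derive] facts; they discharge
    the side conditions of [auto_derive] and replace the [Derive] terms that it leaves. *)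
Ltac differentiate :=
  apply is_derive_Reals; auto_derive;
  [ repeat split; try (eexists; eassumption); auto | derive_with ].

(** Asking for some value [v] at each point spares the caller a derivative function; [Derive f]
    takes that place in the mean value theorem. *)
Lemma nonincreasing_of_deriv (f : R -> R) (x y : R) :
  x <= y ->
  (forall t, x <= t <= y -> exists v, derivable_pt_lim f t v /\ v <= 0) ->
  f y <= f x.
Proof.
  intros [Hxy | <-] Hd; [| lra].
  destruct (MVT_cor2 f (Derive f) x y Hxy) as (z & Hz & Hzi).
  - intros t Ht. destruct (Hd t Ht) as (v & Hv & _).
    apply is_derive_Reals in Hv. rewrite (is_derive_unique _ _ _ Hv).
    now apply is_derive_Reals.
  - destruct (Hd z ltac:(lra)) as (v & Hv & Hle).
    apply is_derive_Reals in Hv. rewrite (is_derive_unique _ _ _ Hv) in Hz.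
    nra.
Qed.

Lemma constant_of_deriv (f : R -> R) (x y : R) :
  x <= y ->
  (forall t, x <= t <= y -> derivable_pt_lim f t 0) ->
  f y = f x.
Proof.
  intros [Hxy | <-] Hd; [| reflexivity].
  destruct (MVT_cor2 f (fun _ => 0) x y Hxy Hd) as (z & Hz & _).
  lra.
Qed.

Lemma primitive_exists (f : R -> R) :
  continuity f ->
  exists F : R -> R, F 0 = 0 /\ forall t, derivable_pt_lim F t (f t).
Proof.
  intros Hf.
  assert (Hc : forall x, continuous f x)
    by (intros x; apply continuity_pt_filterlim, Hf).
  exists (RInt f 0); split.
  - apply (RInt_point 0 f).
  - intros t. apply is_derive_Reals.
    apply (is_derive_RInt f (RInt f 0) 0 t); [| apply Hc].
    apply filter_forall; intros y.
    apply (RInt_correct f), (ex_RInt_continuous f); auto.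
Qed.

Lemma continuity_of_nonexpansive (e : R -> R) :
  (forall x y, Rabs (e x - e y) <= Rabs (x - y)) -> continuity e.
Proof.
  intros He x eps Heps; exists eps; split; [exact Heps |].
  intros y [_ Hy]; simpl in *; unfold R_dist in *.
  eapply Rle_lt_trans; [apply He | exact Hy].
Qed.

(** Primitives are taken of functions continuous on the whole line, while the data are controlled
    only on a segment or for [t >= 0]. Composition with [clamp u v] or [Rmax 0] extends them by
    constants. *)
Definition clamp (u v t : R) : R := Rmax u (Rmin t v).

Lemma clamp_range (u v t : R) : u <= v -> u <= clamp u v t <= v.
Proof.
  intros H; unfold clamp; split; [apply Rmax_l |].
  apply Rmax_lub; [exact H | apply Rmin_r].
Qed.

Lemma clamp_id (u v t : R) : u <= t <= v -> clamp u v t = t.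
Proof.
  intros [H1 H2]; unfold clamp.
  rewrite Rmin_left, Rmax_right; auto.
Qed.

Lemma clamp_continuity (u v : R) : continuity (clamp u v).
Proof.
  apply continuity_of_nonexpansive; intros x y.
  unfold clamp, Rmax, Rmin, Rabs; repeat destruct Rle_dec;
    repeat destruct Rcase_abs; lra.
Qed.

Lemma Rmax_continuity (u : R) : continuity (Rmax u).
Proof.
  apply continuity_of_nonexpansive; intros x y.
  unfold Rmax, Rabs; repeat destruct Rle_dec;
    repeat destruct Rcase_abs; lra.
Qed.

Lemma continuity_comp_range (f e : R -> R) :
  continuity e -> (forall t, continuity_pt f (e t)) ->
  continuity (fun t => f (e t)).
Proof.
  intros He Hf t. apply (continuity_pt_comp e f); [apply He | apply Hf].
Qed.

(** Integrating factor: with [I] a primitive of [k], the product [w exp (- I)] is constant, so [w]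
    keeps its sign. *)
Lemma linear_ode_nonneg (w k : R -> R) (t1 : R) :
  0 <= t1 ->
  (forall t, 0 <= t <= t1 -> continuity_pt k t) ->
  (forall t, 0 <= t <= t1 -> derivable_pt_lim w t (k t * w t)) ->
  0 <= w 0 -> 0 <= w t1.
Proof.
  intros Ht1 Hk Hw H0.
  destruct (primitive_exists (fun t => k (clamp 0 t1 t))) as (I & HI0 & HI).
  { apply continuity_comp_range; [apply clamp_continuity |].
    intros t; apply Hk, clamp_range, Ht1. }
  assert (E : w t1 * exp (- I t1) = w 0 * exp (- I 0)).
  { apply (constant_of_deriv (fun t => w t * exp (- I t))); [exact Ht1 |].
    intros t Ht.
    assert (Hw' := Hw t Ht); assert (HI' := HI t); simpl in HI'.
    rewrite clamp_id in HI' by exact Ht.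
    apply is_derive_Reals in Hw'; apply is_derive_Reals in HI'.
    differentiate. ring. }
  rewrite HI0, Ropp_0, exp_0, Rmult_1_r in E.
  apply (Rmult_le_reg_r (exp (- I t1))); [apply exp_pos |].
  rewrite E; lra.
Qed.

(** * Inverse of a function whose slope is bounded below *)

Lemma inverse_exists (phi phi' : R -> R) (m : R) :
  0 < m -> phi 0 = 0 ->
  (forall t, derivable_pt_lim phi t (phi' t)) ->
  (forall t, m <= phi' t) ->
  exists psi : R -> R,
    (forall u, phi (psi u) = u) /\ (forall t, psi (phi t) = t) /\
    (forall u v, u <= v -> psi u <= psi v) /\
    (forall u, derivable_pt_lim psi u (/ phi' (psi u))).
Proof.
  intros Hm H0 Hd Hge.
  (* Expansion by the factor [m] yields all the rest: surjectivity, monotonicity of the inverse, and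
     its Lipschitz constant [/ m]. *)
  assert (Hgrow : forall x y, x <= y -> m * (y - x) <= phi y - phi x).
  { intros x y [Hxy | <-]; [| lra].
    destruct (MVT_cor2 phi phi' x y Hxy (fun c _ => Hd c)) as (z & Hz & _).
    rewrite Hz; apply Rmult_le_compat_r; [lra | apply Hge]. }
  assert (Hcont : continuity phi).
  { intros x; apply derivable_continuous_pt; exists (phi' x); apply Hd. }
  assert (Hsurj : forall u, {x | phi x = u}).
  { intros u.
    assert (Hu : 0 <= Rabs u / m).
    { apply Rmult_le_pos; [apply Rabs_pos | left; now apply Rinv_0_lt_compat]. }
    assert (Hr : m * (Rabs u / m) = Rabs u) by (field; lra).
    assert (Hp := Hgrow 0 (Rabs u / m) Hu).
    assert (Hq := Hgrow (- (Rabs u / m)) 0 ltac:(lra)).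
    assert (Hau := Rle_abs u). assert (Hau' := Rle_abs (- u)).
    rewrite Rabs_Ropp in Hau'.
    (* Since [phi 0 = 0], the values of [phi] at the two endpoints lie on either side of [u]. *)
    destruct (IVT_cor (fun x => phi x - u) (- (Rabs u / m)) (Rabs u / m))
      as (x & _ & Hx).
    - apply continuity_minus; [exact Hcont | apply continuity_const; easy].
    - lra.
    - assert (phi (- (Rabs u / m)) <= u) by nra.
      assert (u <= phi (Rabs u / m)) by nra.
      nra.
    - exists x; lra. }
  exists (fun u => proj1_sig (Hsurj u)).
  assert (Hinv : forall u, phi (proj1_sig (Hsurj u)) = u)
    by (intros u; apply (proj2_sig (Hsurj u))).
  set (psi := fun u => proj1_sig (Hsurj u)) in *.
  assert (Hmono : forall u v, u <= v -> psi u <= psi v).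
  { intros u v Huv. destruct (Rle_or_lt (psi u) (psi v)) as [H | H]; [exact H |].
    assert (Hg := Hgrow (psi v) (psi u) ltac:(lra)).
    unfold psi in Hg at 3 4; rewrite !Hinv in Hg. nra. }
  assert (Hlip : forall u v, Rabs (psi u - psi v) <= / m * Rabs (u - v)).
  { assert (Hl : forall u v, u <= v -> psi v - psi u <= / m * (v - u)).
    { intros u v Huv.
      assert (Hg := Hgrow (psi u) (psi v) (Hmono u v Huv)).
      unfold psi in Hg at 3 4; rewrite !Hinv in Hg.
      apply (Rmult_le_reg_l m); [exact Hm |].
      rewrite <- Rmult_assoc, Rinv_r, Rmult_1_l by lra. exact Hg. }
    intros u v. destruct (Rle_or_lt u v) as [H | H].
    - rewrite (Rabs_left1 (u - v)), (Rabs_left1 (psi u - psi v)).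
      + specialize (Hl u v H); lra.
      + specialize (Hmono u v H); lra.
      + lra.
    - assert (H' : v <= u) by lra.
      rewrite (Rabs_pos_eq (u - v)), (Rabs_pos_eq (psi u - psi v)).
      + apply (Hl v u H').
      + specialize (Hmono v u H'); lra.
      + lra. }
  split; [exact Hinv |]. split; [| split; [exact Hmono |]].
  { intros t. assert (E := Hinv (phi t)); fold (psi (phi t)) in E.
    change (psi (phi t) = t).
    destruct (Rtotal_order (psi (phi t)) t) as [H | [H | H]]; [| exact H |].
    - assert (Hg := Hgrow _ _ (Rlt_le _ _ H)). unfold psi in *. nra.
    - assert (Hg := Hgrow _ _ (Rlt_le _ _ H)). unfold psi in *. nra. }
  intros u eps Heps.
  assert (Hl : 0 < phi' (psi u)) by (specialize (Hge (psi u)); lra).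
  set (l := phi' (psi u)) in *.
  (* If q is a difference quotient of phi, then |1/q - 1/l| <= |q - l| / m^2. *)
  destruct (Hd (psi u) (eps * m * m)) as (del & Hdel).
  { repeat apply Rmult_lt_0_compat; assumption. }
  assert (Hd' : 0 < del * m).
  { apply Rmult_lt_0_compat; [apply cond_pos | exact Hm]. }
  exists (mkposreal _ Hd'); simpl; intros h Hh Hhd.
  set (k := psi (u + h) - psi u).
  assert (Hphi : phi (psi u + k) - phi (psi u) = h).
  { unfold k; replace (psi u + (psi (u + h) - psi u)) with (psi (u + h)) by ring.
    unfold psi; rewrite !Hinv; ring. }
  assert (Hk0 : k <> 0).
  { intros E; rewrite E, Rplus_0_r in Hphi; lra. }
  assert (Hk : Rabs k < del).
  { eapply Rle_lt_trans; [apply Hlip |].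
    replace (u + h - u) with h by ring.
    apply (Rmult_lt_reg_l m); [exact Hm |].
    rewrite <- Rmult_assoc, Rinv_r, Rmult_1_l by lra. lra. }
  specialize (Hdel k Hk0 Hk). rewrite Hphi in Hdel. fold l in Hdel.
  assert (Hq : m <= h / k).
  { destruct (Rtotal_order 0 k) as [Hkp | [Hkz | Hkn]]; [| lra |].
    - assert (Hg := Hgrow (psi u) (psi u + k) ltac:(lra)).
      apply (Rmult_le_reg_r k); [exact Hkp |].
      unfold Rdiv; rewrite Rmult_assoc, Rinv_l by lra. lra.
    - assert (Hg := Hgrow (psi u + k) (psi u) ltac:(lra)).
      apply (Rmult_le_reg_r (- k)); [lra |].
      replace (h / k * - k) with (- h) by (field; lra). lra. }
  assert (Hlm : m <= l) by apply Hge.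
  set (q := h / k) in *.
  assert (Hh0 : h = q * k) by (unfold q; field; exact Hk0).
  change (phi' (proj1_sig (Hsurj u))) with l.
  replace (k / h - / l) with ((l - q) * / (q * l)).
  2:{ rewrite Hh0. field. repeat split; lra. }
  rewrite Rabs_mult, (Rabs_pos_eq (/ (q * l))).
  2:{ left; apply Rinv_0_lt_compat; nra. }
  rewrite Rabs_minus_sym.
  apply (Rmult_lt_reg_r (q * l)); [nra |].
  rewrite Rmult_assoc, Rinv_l, Rmult_1_r by nra.
  eapply Rlt_le_trans; [exact Hdel |].
  rewrite Rmult_assoc. apply Rmult_le_compat_l; [lra | nra].
Qed.

(** * Uniqueness for locally Lipschitz systems in four unknowns *)

Definition box (M x0 x1 x2 x3 : R) : Prop :=
  Rabs x0 <= M /\ Rabs x1 <= M /\ Rabs x2 <= M /\ Rabs x3 <= M.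

Definition dist1 (x0 x1 x2 x3 y0 y1 y2 y3 : R) : R :=
  Rabs (x0 - y0) + Rabs (x1 - y1) + Rabs (x2 - y2) + Rabs (x3 - y3).

(* Boundedness on boxes is built in because the product rule needs it. *)
Definition loc_lipschitz (F : R -> R -> R -> R -> R) : Prop :=
  forall M, exists L, 0 <= L /\
    (forall x0 x1 x2 x3, box M x0 x1 x2 x3 -> Rabs (F x0 x1 x2 x3) <= L) /\
    (forall x0 x1 x2 x3 y0 y1 y2 y3,
       box M x0 x1 x2 x3 -> box M y0 y1 y2 y3 ->
       Rabs (F x0 x1 x2 x3 - F y0 y1 y2 y3)
       <= L * dist1 x0 x1 x2 x3 y0 y1 y2 y3).

Lemma dist1_nonneg (x0 x1 x2 x3 y0 y1 y2 y3 : R) :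
  0 <= dist1 x0 x1 x2 x3 y0 y1 y2 y3.
Proof.
  unfold dist1.
  assert (H0 := Rabs_pos (x0 - y0)). assert (H1 := Rabs_pos (x1 - y1)).
  assert (H2 := Rabs_pos (x2 - y2)). assert (H3 := Rabs_pos (x3 - y3)).
  lra.
Qed.

Lemma loc_lipschitz_const (k : R) : loc_lipschitz (fun _ _ _ _ => k).
Proof.
  intros M; exists (Rabs k); split; [apply Rabs_pos |]; split.
  - intros; lra.
  - intros. rewrite Rminus_diag, Rabs_R0.
    apply Rmult_le_pos; [apply Rabs_pos | apply dist1_nonneg].
Qed.

Lemma loc_lipschitz_proj (F : R -> R -> R -> R -> R) :
  (forall x0 x1 x2 x3 M, box M x0 x1 x2 x3 -> Rabs (F x0 x1 x2 x3) <= M) ->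
  (forall x0 x1 x2 x3 y0 y1 y2 y3,
     Rabs (F x0 x1 x2 x3 - F y0 y1 y2 y3) <= dist1 x0 x1 x2 x3 y0 y1 y2 y3) ->
  loc_lipschitz F.
Proof.
  (* A single constant must bound both the values, by [M], and the Lipschitz quotient, by 1. *)
  intros Hb Hl M; exists (Rmax 1 M); split; [| split].
  - assert (H := Rmax_l 1 M); lra.
  - intros x0 x1 x2 x3 H; eapply Rle_trans; [apply Hb, H | apply Rmax_r].
  - intros x0 x1 x2 x3 y0 y1 y2 y3 _ _.
    eapply Rle_trans; [apply Hl |].
    assert (H := dist1_nonneg x0 x1 x2 x3 y0 y1 y2 y3).
    assert (H' := Rmax_l 1 M). nra.
Qed.

Lemma loc_lipschitz_plus (F G : R -> R -> R -> R -> R) :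
  loc_lipschitz F -> loc_lipschitz G ->
  loc_lipschitz (fun x0 x1 x2 x3 => F x0 x1 x2 x3 + G x0 x1 x2 x3).
Proof.
  intros HF HG M.
  destruct (HF M) as (L & HL & HF1 & HF2).
  destruct (HG M) as (K & HK & HG1 & HG2).
  exists (L + K); split; [lra |]; split.
  - intros x0 x1 x2 x3 H. eapply Rle_trans; [apply Rabs_triang |].
    apply Rplus_le_compat; auto.
  - intros x0 x1 x2 x3 y0 y1 y2 y3 Hx Hy.
    replace (F x0 x1 x2 x3 + G x0 x1 x2 x3 - (F y0 y1 y2 y3 + G y0 y1 y2 y3))
      with (F x0 x1 x2 x3 - F y0 y1 y2 y3 + (G x0 x1 x2 x3 - G y0 y1 y2 y3))
      by ring.
    eapply Rle_trans; [apply Rabs_triang |].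
    rewrite Rmult_plus_distr_r. apply Rplus_le_compat; auto.
Qed.

Lemma loc_lipschitz_mult (F G : R -> R -> R -> R -> R) :
  loc_lipschitz F -> loc_lipschitz G ->
  loc_lipschitz (fun x0 x1 x2 x3 => F x0 x1 x2 x3 * G x0 x1 x2 x3).
Proof.
  intros HF HG M.
  destruct (HF M) as (L & HL & HF1 & HF2).
  destruct (HG M) as (K & HK & HG1 & HG2).
  (* Each of the two terms of the product rule contributes [L * K]. *)
  exists (2 * L * K); split; [nra |]; split.
  - intros x0 x1 x2 x3 H. rewrite Rabs_mult.
    apply Rle_trans with (L * K); [| nra].
    apply Rmult_le_compat; auto using Rabs_pos.
  - intros x0 x1 x2 x3 y0 y1 y2 y3 Hx Hy.
    replace (F x0 x1 x2 x3 * G x0 x1 x2 x3 - F y0 y1 y2 y3 * G y0 y1 y2 y3)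
      with (F x0 x1 x2 x3 * (G x0 x1 x2 x3 - G y0 y1 y2 y3)
            + (F x0 x1 x2 x3 - F y0 y1 y2 y3) * G y0 y1 y2 y3)
      by ring.
    eapply Rle_trans; [apply Rabs_triang |].
    rewrite !Rabs_mult.
    set (d := dist1 x0 x1 x2 x3 y0 y1 y2 y3).
    replace (2 * L * K * d) with (L * (K * d) + L * d * K) by ring.
    apply Rplus_le_compat; apply Rmult_le_compat; try apply Rabs_pos; auto.
Qed.

Lemma loc_lipschitz_opp (F : R -> R -> R -> R -> R) :
  loc_lipschitz F -> loc_lipschitz (fun x0 x1 x2 x3 => - F x0 x1 x2 x3).
Proof.
  intros HF M. destruct (HF M) as (L & HL & HF1 & HF2).
  exists L; split; [exact HL |]; split.
  - intros; rewrite Rabs_Ropp; auto.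
  - intros x0 x1 x2 x3 y0 y1 y2 y3 Hx Hy.
    replace (- F x0 x1 x2 x3 - - F y0 y1 y2 y3)
      with (- (F x0 x1 x2 x3 - F y0 y1 y2 y3)) by ring.
    rewrite Rabs_Ropp; auto.
Qed.

Lemma loc_lipschitz_minus (F G : R -> R -> R -> R -> R) :
  loc_lipschitz F -> loc_lipschitz G ->
  loc_lipschitz (fun x0 x1 x2 x3 => F x0 x1 x2 x3 - G x0 x1 x2 x3).
Proof.
  intros HF HG. apply loc_lipschitz_plus; [exact HF |].
  now apply loc_lipschitz_opp.
Qed.

Lemma loc_lipschitz_pow (F : R -> R -> R -> R -> R) (n : nat) :
  loc_lipschitz F -> loc_lipschitz (fun x0 x1 x2 x3 => F x0 x1 x2 x3 ^ n).
Proof.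
  intros HF; induction n as [| n IH]; simpl.
  - apply loc_lipschitz_const.
  - now apply loc_lipschitz_mult.
Qed.

Ltac loc_lip :=
  first
  [ apply loc_lipschitz_const
  | apply loc_lipschitz_plus; loc_lip
  | apply loc_lipschitz_minus; loc_lip
  | apply loc_lipschitz_mult; loc_lip
  | apply loc_lipschitz_opp; loc_lip
  | apply loc_lipschitz_pow; loc_lip
  | apply loc_lipschitz_proj;
    [ intros ? ? ? ? ? (? & ? & ? & ?); assumption
    | intros x0 x1 x2 x3 y0 y1 y2 y3; unfold dist1;
      pose proof (Rabs_pos (x0 - y0)); pose proof (Rabs_pos (x1 - y1));
      pose proof (Rabs_pos (x2 - y2)); pose proof (Rabs_pos (x3 - y3));
      lra ] ].

Lemma bounded_on_segment (f f' : R -> R) (T : R) :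
  0 <= T -> (forall t, 0 <= t -> derivable_pt_lim f t (f' t)) ->
  exists M, forall t, 0 <= t <= T -> Rabs (f t) <= M.
Proof.
  intros HT Hf.
  destruct (continuity_ab_maj (fun t => Rabs (f t)) 0 T HT) as (m & Hm & _).
  - intros t [Ht _]. apply (continuity_pt_comp f Rabs); [| apply Rcontinuity_abs].
    apply derivable_continuous_pt; exists (f' t); now apply Hf.
  - now exists (Rabs (f m)).
Qed.

Lemma box_on_segment (f0 f1 f2 f3 d0 d1 d2 d3 : R -> R) (T : R) :
  0 <= T ->
  (forall t, 0 <= t ->
     derivable_pt_lim f0 t (d0 t) /\ derivable_pt_lim f1 t (d1 t) /\
     derivable_pt_lim f2 t (d2 t) /\ derivable_pt_lim f3 t (d3 t)) ->
  exists M, forall t, 0 <= t <= T -> box M (f0 t) (f1 t) (f2 t) (f3 t).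
Proof.
  intros HT H.
  destruct (bounded_on_segment f0 d0 T HT) as (M0 & H0); [intros; now apply H |].
  destruct (bounded_on_segment f1 d1 T HT) as (M1 & H1); [intros; now apply H |].
  destruct (bounded_on_segment f2 d2 T HT) as (M2 & H2); [intros; now apply H |].
  destruct (bounded_on_segment f3 d3 T HT) as (M3 & H3); [intros; now apply H |].
  exists (Rmax (Rmax M0 M1) (Rmax M2 M3)); intros t Ht.
  repeat split; (eapply Rle_trans; [eauto |]);
    eauto using Rle_trans, Rmax_l, Rmax_r.
Qed.

Lemma box_le (M N x0 x1 x2 x3 : R) :
  M <= N -> box M x0 x1 x2 x3 -> box N x0 x1 x2 x3.
Proof. unfold box; intros; lra. Qed.

(** The factor 4 is the Cauchy-Schwarz constant that bounds the square of a sum of four terms by the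
    sum of their squares. *)
Lemma lipschitz_pairing (L e d0 d1 d2 d3 x : R) :
  0 <= L ->
  Rabs x <= L * (Rabs d0 + Rabs d1 + Rabs d2 + Rabs d3) ->
  Rabs e <= Rabs d0 + Rabs d1 + Rabs d2 + Rabs d3 ->
  e * x <= 4 * L * (d0^2 + d1^2 + d2^2 + d3^2).
Proof.
  intros HL Hx He.
  rewrite <- (pow2_abs d0), <- (pow2_abs d1), <- (pow2_abs d2), <- (pow2_abs d3).
  set (S := Rabs d0 + Rabs d1 + Rabs d2 + Rabs d3) in *.
  assert (HS : S^2 <= 4 * (Rabs d0^2 + Rabs d1^2 + Rabs d2^2 + Rabs d3^2)).
  { unfold S. generalize (Rabs d0) (Rabs d1) (Rabs d2) (Rabs d3); intros a b c d.
    assert (H0 := pow2_ge_0 (a-b)). assert (H1 := pow2_ge_0 (a-c)).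
    assert (H2 := pow2_ge_0 (a-d)). assert (H3 := pow2_ge_0 (b-c)).
    assert (H4 := pow2_ge_0 (b-d)). assert (H5 := pow2_ge_0 (c-d)). nra. }
  apply Rle_trans with (S * (L * S)).
  - eapply Rle_trans; [apply Rle_abs |]. rewrite Rabs_mult.
    apply Rmult_le_compat; auto using Rabs_pos.
  - replace (S * (L * S)) with (L * S^2) by ring. nra.
Qed.

(** Gronwall argument: the squared distance [N] satisfies [N' <= L N], so [N exp (- L t)] is
    nonincreasing, and it starts at 0. *)
Lemma ode_unique (F0 F1 F2 F3 : R -> R -> R -> R -> R)
    (f0 f1 f2 f3 g0 g1 g2 g3 : R -> R) :
  loc_lipschitz F0 -> loc_lipschitz F1 ->
  loc_lipschitz F2 -> loc_lipschitz F3 ->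
  f0 0 = g0 0 -> f1 0 = g1 0 -> f2 0 = g2 0 -> f3 0 = g3 0 ->
  (forall t, 0 <= t ->
     derivable_pt_lim f0 t (F0 (f0 t) (f1 t) (f2 t) (f3 t)) /\
     derivable_pt_lim f1 t (F1 (f0 t) (f1 t) (f2 t) (f3 t)) /\
     derivable_pt_lim f2 t (F2 (f0 t) (f1 t) (f2 t) (f3 t)) /\
     derivable_pt_lim f3 t (F3 (f0 t) (f1 t) (f2 t) (f3 t))) ->
  (forall t, 0 <= t ->
     derivable_pt_lim g0 t (F0 (g0 t) (g1 t) (g2 t) (g3 t)) /\
     derivable_pt_lim g1 t (F1 (g0 t) (g1 t) (g2 t) (g3 t)) /\
     derivable_pt_lim g2 t (F2 (g0 t) (g1 t) (g2 t) (g3 t)) /\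
     derivable_pt_lim g3 t (F3 (g0 t) (g1 t) (g2 t) (g3 t))) ->
  forall t, 0 <= t ->
    f0 t = g0 t /\ f1 t = g1 t /\ f2 t = g2 t /\ f3 t = g3 t.
Proof.
  intros HF0 HF1 HF2 HF3 E0 E1 E2 E3 Hf Hg T HT.
  destruct (box_on_segment _ _ _ _ _ _ _ _ T HT Hf) as (Mf & HMf).
  destruct (box_on_segment _ _ _ _ _ _ _ _ T HT Hg) as (Mg & HMg).
  set (M := Rmax Mf Mg).
  assert (Bf : forall t, 0 <= t <= T -> box M (f0 t) (f1 t) (f2 t) (f3 t)).
  { intros t Ht; apply (box_le Mf); [apply Rmax_l | now apply HMf]. }
  assert (Bg : forall t, 0 <= t <= T -> box M (g0 t) (g1 t) (g2 t) (g3 t)).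
  { intros t Ht; apply (box_le Mg); [apply Rmax_r | now apply HMg]. }
  destruct (HF0 M) as (L0 & P0 & _ & Q0).
  destruct (HF1 M) as (L1 & P1 & _ & Q1).
  destruct (HF2 M) as (L2 & P2 & _ & Q2).
  destruct (HF3 M) as (L3 & P3 & _ & Q3).
  (* The 8 is the 2 from differentiating squares times the 4 of [lipschitz_pairing]. *)
  set (L := 8 * (L0 + L1 + L2 + L3)).
  set (N := fun t =>
    (f0 t - g0 t)^2 + (f1 t - g1 t)^2 + (f2 t - g2 t)^2 + (f3 t - g3 t)^2).
  set (D := fun F : R -> R -> R -> R -> R => fun t =>
    F (f0 t) (f1 t) (f2 t) (f3 t) - F (g0 t) (g1 t) (g2 t) (g3 t)).
  assert (Hdec : N T * exp (- L * T) <= N 0 * exp (- L * 0)).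
  { apply (nonincreasing_of_deriv (fun t => N t * exp (- L * t)) 0 T HT).
    intros t Ht.
    exists ((2 * ((f0 t - g0 t) * D F0 t + (f1 t - g1 t) * D F1 t
                 + (f2 t - g2 t) * D F2 t + (f3 t - g3 t) * D F3 t) - L * N t)
                * exp (- L * t)); split.
    - destruct (Hf t (proj1 Ht)) as (A0 & A1 & A2 & A3).
      destruct (Hg t (proj1 Ht)) as (B0 & B1 & B2 & B3).
      apply is_derive_Reals in A0, A1, A2, A3, B0, B1, B2, B3.
      unfold N, D. differentiate. ring.
    - specialize (Bf t Ht); specialize (Bg t Ht).
      assert (X : forall K F e, 0 <= K ->
        (forall x0 x1 x2 x3 y0 y1 y2 y3,
          box M x0 x1 x2 x3 -> box M y0 y1 y2 y3 ->
          Rabs (F x0 x1 x2 x3 - F y0 y1 y2 y3)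
          <= K * dist1 x0 x1 x2 x3 y0 y1 y2 y3) ->
        Rabs e <= Rabs (f0 t - g0 t) + Rabs (f1 t - g1 t)
                  + Rabs (f2 t - g2 t) + Rabs (f3 t - g3 t) ->
        e * D F t <= 4 * K * N t).
      { intros K F e HK HF He. apply lipschitz_pairing; [exact HK | | exact He].
        now apply HF. }
      assert (h0 := Rabs_pos (f0 t - g0 t)). assert (h1 := Rabs_pos (f1 t - g1 t)).
      assert (h2 := Rabs_pos (f2 t - g2 t)). assert (h3 := Rabs_pos (f3 t - g3 t)).
      assert (X0 := X L0 F0 (f0 t - g0 t) P0 Q0 ltac:(lra)).
      assert (X1 := X L1 F1 (f1 t - g1 t) P1 Q1 ltac:(lra)).
      assert (X2 := X L2 F2 (f2 t - g2 t) P2 Q2 ltac:(lra)).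
      assert (X3 := X L3 F3 (f3 t - g3 t) P3 Q3 ltac:(lra)).
      assert (He := exp_pos (- L * t)).
      assert (2 * ((f0 t - g0 t) * D F0 t + (f1 t - g1 t) * D F1 t
                 + (f2 t - g2 t) * D F2 t + (f3 t - g3 t) * D F3 t) - L * N t <= 0)
        by (unfold L; lra).
      nra. }
  assert (HN0 : N 0 = 0) by (unfold N; rewrite E0, E1, E2, E3; ring).
  rewrite HN0, Rmult_0_l in Hdec.
  assert (HNT : N T <= 0).
  { assert (He := exp_pos (- L * T)). nra. }
  unfold N in HNT.
  assert (k0 := pow2_ge_0 (f0 T - g0 T)). assert (k1 := pow2_ge_0 (f1 T - g1 T)).
  assert (k2 := pow2_ge_0 (f2 T - g2 T)). assert (k3 := pow2_ge_0 (f3 T - g3 T)).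
  assert (Z : forall x y, (x - y)^2 = 0 -> x = y).
  { intros x y H. apply Rminus_diag_uniq. 
    destruct (Req_dec (x - y) 0) as [H' | H']; [exact H' |].
    now apply (pow_nonzero _ 2) in H'. }
  repeat split; apply Z; lra.
Qed.

(** The right sides of (S3) are polynomials, hence locally Lipschitz. This carries the asymptotics
    of one explicit solution over to all. *)
Lemma S3_unique (h0 h1 h2 h3 : R) (f0 f1 f2 f3 g0 g1 g2 g3 : R -> R) :
  S3_global_solution h0 h1 h2 h3 f0 f1 f2 f3 ->
  S3_global_solution h0 h1 h2 h3 g0 g1 g2 g3 ->
  forall t, 0 <= t ->
    f0 t = g0 t /\ f1 t = g1 t /\ f2 t = g2 t /\ f3 t = g3 t.
Proof.
  intros (A0 & A1 & A2 & A3 & A) (B0 & B1 & B2 & B3 & B).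
  set (beta := betaC h0 h1 h2 h3) in *.
  apply (ode_unique
    (fun x0 x1 x2 x3 => - beta * pP x1 x2 x3 * x0^3)
    (fun x0 x1 x2 x3 => - beta * qP x1 x2 x3 * x0^2 * x1)
    (fun x0 x1 x2 x3 => - beta * qP x2 x3 x1 * x0^2 * x2)
    (fun x0 x1 x2 x3 => - beta * qP x3 x1 x2 * x0^2 * x3));
    try congruence; try assumption; unfold pP, qP; loc_lip.
Qed.

(** * The planar system: order, elongation, infinite lifetime *)

Definition aP (dh : R) (b c : R -> R) (t : R) : R := dh / (b t * c t).

Lemma aP_pos (dh : R) (b c : R -> R) (t : R) :
  0 < dh -> 0 < b t -> 0 < c t -> 0 < aP dh b c t.
Proof.
  intros Hd Hb Hc; apply Rdiv_lt_0_compat; [exact Hd |].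
  now apply Rmult_lt_0_compat.
Qed.

Lemma in_dom_le (T : option R) (s t : R) :
  0 <= s <= t -> in_dom T t -> in_dom T s.
Proof. destruct T as [T' |]; unfold in_dom; intros; repeat split; lra. Qed.

Lemma P_gap_deriv (dh : R) (T : option R) (b c : R -> R) (t : R) :
  P_solution dh T b c -> in_dom T t ->
  derivable_pt_lim (fun t => c t - b t) t
    (- (2/3) * kappaP (aP dh b c t) (b t) (c t) * (c t - b t)).
Proof.
  intros HP Ht. destruct (HP t Ht) as (_ & _ & Hb & Hc).
  fold (aP dh b c t) in Hb, Hc.
  apply is_derive_Reals in Hb, Hc. differentiate.
  assert (E := rP_difference (aP dh b c t) (b t) (c t)). lra.
Qed.

(** The gap solves a linear equation with continuous coefficient, so it stays nonnegative. *)
Lemma P_order (dh : R) (T : option R) (b c : R -> R) (t : R) :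
  P_solution dh T b c -> b 0 <= c 0 -> in_dom T t -> b t <= c t.
Proof.
  intros HP H0 Ht.
  enough (0 <= c t - b t) by lra.
  apply (linear_ode_nonneg (fun t => c t - b t)
    (fun t => - (2/3) * kappaP (aP dh b c t) (b t) (c t))); [apply Ht | | | lra].
  - intros u Hu. assert (Hd := in_dom_le T u t Hu Ht).
    destruct (HP u Hd) as (Hb0 & Hc0 & Hb & Hc).
    apply is_derive_Reals in Hb, Hc.
    apply continuity_pt_filterlim.
    apply (ex_derive_continuous
      (fun t => - (2/3) * kappaP (aP dh b c t) (b t) (c t)) u).
    unfold kappaP, aP. auto_derive.
    repeat split; try (eexists; eassumption); apply Rgt_not_eq; nra.
  - intros u Hu. apply (P_gap_deriv dh T); [exact HP |].
    now apply (in_dom_le T u t).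
Qed.

Lemma P_eventually_elongated (dh : R) (T : option R) (b c : R -> R) :
  0 < dh -> P_solution dh T b c -> b 0 <= c 0 ->
  to_infty_at T b -> to_infty_at T c ->
  exists t0, in_dom T t0 /\ forall t, t0 <= t -> in_dom T t ->
    elongated (aP dh b c t) (b t) (c t) /\ aP dh b c t * b t <= 1.
Proof.
  intros Hd HP H0 Hb Hc.
  (* Above this threshold [a b = dh / c < 1] and [10 a = 10 dh / (b c) < b], and also [c > 1]. *)
  destruct (Hb (1 + 10 * dh)) as (t1 & Ht1 & Hb1).
  destruct (Hc (1 + 10 * dh)) as (t2 & Ht2 & Hc2).
  exists (Rmax t1 t2); split.
  { unfold Rmax; destruct Rle_dec; assumption. }
  intros t Ht Hdom.
  assert (Hbt : 1 + 10 * dh < b t) by (apply Hb1, Hdom; eapply Rle_trans, Ht; apply Rmax_l).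
  assert (Hct : 1 + 10 * dh < c t) by (apply Hc2, Hdom; eapply Rle_trans, Ht; apply Rmax_r).
  assert (Hbc : b t <= c t) by (apply (P_order dh T); assumption).
  assert (Ha : 0 < aP dh b c t) by (apply aP_pos; lra).
  assert (E : aP dh b c t * (b t * c t) = dh) by (unfold aP; field; lra).
  assert (aP dh b c t * b t <= 1 /\ 10 * aP dh b c t <= b t).
  { generalize dependent (aP dh b c t); intros a Ha E.
    assert (Hbc1 : 1 < b t * c t) by nra.
    split; apply Rnot_lt_le; intros Hn.
    - assert (0 < (a * b t - 1) * c t) by (apply Rmult_lt_0_compat; lra). lra.
    - assert (0 < (10 * a - b t) * (b t * c t)) by (apply Rmult_lt_0_compat; lra).
      nra. }
  unfold elongated; repeat split; lra.
Qed.

Definition lyapunovP (b c : R -> R) (t : R) : R := ln (b t) + 20 * (c t - b t).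

(* The decay of the gap absorbs the contribution of [c - b] to the growth of [ln b]. *)
Lemma lyapunovP_deriv (dh : R) (T : option R) (b c : R -> R) (t : R) :
  P_solution dh T b c -> in_dom T t ->
  elongated (aP dh b c t) (b t) (c t) ->
  exists v, derivable_pt_lim (lyapunovP b c) t v /\
    v <= 2/3 * ((aP dh b c t)^2 * b t^2) - 90 * (c t^3 * (c t - b t)).
Proof.
  intros HP Ht He.
  exists (- (2/3) * rP (b t) (aP dh b c t) (c t)
    + 20 * (- (2/3) * kappaP (aP dh b c t) (b t) (c t) * (c t - b t))).
  split.
  - assert (Hg := P_gap_deriv dh T b c t HP Ht).
    destruct (HP t Ht) as (Hb0 & _ & Hb & _).
    fold (aP dh b c t) in Hb.
    apply (derivable_pt_lim_plus (fun t => ln (b t)) (fun t => 20 * (c t - b t))).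
    + apply is_derive_Reals in Hb. differentiate. field; lra.
    + apply (derivable_pt_lim_scal (fun t => c t - b t)), Hg.
  (* In units of [c^3 (c - b)], [ln b] gains at most [(2/3) 20 = 40/3] while the gap term loses at
     least [20 (2/3) 8 = 320/3]; the net loss [280/3] exceeds 90. *)
  - assert (Hr := rP_ge _ _ _ He). assert (Hk := kappaP_ge _ _ _ He).
    destruct He as (_ & _ & Hbc & Hc1).
    assert (Hc3 : 0 < c t^3) by (apply pow_lt; lra).
    assert (Hk' : 8 * c t^3 <= kappaP (aP dh b c t) (b t) (c t)) by nra.
    assert (Hw : 8 * c t^3 * (c t - b t)
                 <= kappaP (aP dh b c t) (b t) (c t) * (c t - b t))
      by (apply Rmult_le_compat_r; lra).
    nra.
Qed.

Lemma P_time_infinite (dh : R) (T : option R) (b c : R -> R) :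
  0 < dh -> P_solution dh T b c -> b 0 <= c 0 ->
  to_infty_at T b -> to_infty_at T c -> T = None.
Proof.
  intros Hd HP H0 Hb Hc. destruct T as [T' |]; [exfalso | reflexivity].
  destruct (P_eventually_elongated dh (Some T') b c) as (t0 & Ht0 & He); auto.
  (* From [t0] on, [a b <= 1] keeps the slope of [lyapunovP] below 1, so before time [T'] its value,
     and with it [ln b], stays under [K]. *)
  set (K := lyapunovP b c t0 - t0 + T').
  destruct (Hb (exp K)) as (t1 & Ht1 & Hb1).
  set (t := Rmax t0 t1).
  assert (Hdom : in_dom (Some T') t) by (unfold t, Rmax; destruct Rle_dec; assumption).
  assert (Htt : t0 <= t) by apply Rmax_l.
  assert (Hbt : exp K < b t) by (apply Hb1, Hdom; apply Rmax_r).
  assert (HL : lyapunovP b c t - t <= lyapunovP b c t0 - t0).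
  { apply (nonincreasing_of_deriv (fun u => lyapunovP b c u - u) t0 t Htt).
    intros u Hu.
    assert (Hud : in_dom (Some T') u).
    { apply (in_dom_le _ u t); [| exact Hdom]. destruct Ht0; lra. }
    destruct (He u (proj1 Hu) Hud) as (Heu & Hab).
    destruct (lyapunovP_deriv dh (Some T') b c u HP Hud Heu) as (v & Hv & Hle).
    exists (v - 1); split.
    - apply (derivable_pt_lim_minus (lyapunovP b c) id); [exact Hv |].
      apply derivable_pt_lim_id.
    - destruct Heu as (Ha & Hba & Hbc & Hc1).
      assert (0 <= c u^3 * (c u - b u))
        by (apply Rmult_le_pos; [apply pow_le |]; lra).
      rewrite <- Rpow_mult_distr in Hle.
      assert (0 <= aP dh b c u * b u) by nra.
      assert ((aP dh b c u * b u)^2 <= 1) by nra. lra. }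
  assert (Hlb : ln (b t) <= lyapunovP b c t).
  { unfold lyapunovP. assert (b t <= c t) by (apply (P_order dh (Some T')); auto). lra. }
  assert (HK : K < ln (b t)).
  { rewrite <- (ln_exp K). apply ln_increasing; [apply exp_pos | exact Hbt]. }
  destruct Hdom as [_ Hdom]. unfold K in HK. lra.
Qed.

(** * Asymptotics in the time of (P) *)

Definition conformal_factor (dh : R) (b c s : R -> R) : Prop :=
  forall t, 0 <= t -> 0 < s t /\
    derivable_pt_lim s t (- (1/3) * pP (aP dh b c t) (b t) (c t) * s t).

Lemma in_dom_None (t : R) : 0 <= t -> in_dom None t.
Proof. now split. Qed.

Lemma tends_to_0_of_ln (f b : R -> R) (k K t0 : R) :
  0 < k -> 0 <= t0 -> tends_to_infty b ->
  (forall t, t0 <= t -> 0 < f t /\ ln (f t) + k * ln (b t) <= K) ->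
  tends_to f 0.
Proof.
  intros Hk Ht0 Hb Hf eps Heps.
  (* This bound on [b] is what makes [K - k ln b < ln eps]. *)
  destruct (Hb (exp ((K - ln eps) / k))) as (t1 & [Ht1 _] & Hb1).
  exists (Rmax t0 t1); intros t Ht.
  assert (H0 : t0 <= t) by (eapply Rle_trans, Ht; apply Rmax_l).
  assert (H1 : t1 <= t) by (eapply Rle_trans, Ht; apply Rmax_r).
  destruct (Hf t H0) as (Hpos & HK).
  assert (Hbt := Hb1 t H1 (in_dom_None t ltac:(lra))).
  apply ln_increasing in Hbt; [| apply exp_pos].
  rewrite ln_exp in Hbt.
  apply (Rmult_lt_compat_l k) in Hbt; [| exact Hk].
  replace (k * ((K - ln eps) / k)) with (K - ln eps) in Hbt by (field; lra).
  rewrite Rminus_0_r, Rabs_pos_eq by lra.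
  apply ln_lt_inv; lra.
Qed.

Lemma tends_to_0_of_exp (f : R -> R) (K t0 : R) :
  (forall t, t0 <= t -> 0 <= f t /\ f t * exp t <= K) -> tends_to f 0.
Proof.
  intros Hf eps Heps.
  exists (Rmax t0 (K / eps)); intros t Ht.
  assert (H0 : t0 <= t) by (eapply Rle_trans, Ht; apply Rmax_l).
  assert (H1 : K / eps <= t) by (eapply Rle_trans, Ht; apply Rmax_r).
  destruct (Hf t H0) as (Hpos & HK).
  rewrite Rminus_0_r, Rabs_pos_eq by lra.
  assert (He := exp_ineq1_le t).
  assert (HKt : K <= t * eps).
  { apply (Rmult_le_compat_r eps) in H1; [| lra].
    replace (K / eps * eps) with K in H1 by (field; lra). exact H1. }
  assert (He' := exp_pos t).
  apply (Rmult_lt_reg_r (exp t)); [exact He' |]. nra.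
Qed.

Lemma g1_deriv (dh : R) (b c s : R -> R) (t : R) :
  P_solution dh None b c -> conformal_factor dh b c s -> 0 <= t ->
  derivable_pt_lim (fun t => aP dh b c t / s t) t
    (- qP (aP dh b c t) (b t) (c t) * (aP dh b c t / s t)).
Proof.
  intros HP Hs Ht.
  destruct (HP t (in_dom_None t Ht)) as (Hb0 & Hc0 & Hb & Hc).
  destruct (Hs t Ht) as (Hs0 & Hs1).
  fold (aP dh b c t) in Hb, Hc.
  apply is_derive_Reals in Hb, Hc, Hs1.
  unfold aP at 1. differentiate; try (apply Rgt_not_eq; nra).
  (* The new expression is the logarithmic derivative of [a / s = dh / (b c s)]: each of [b], [c]
     contributes [(2/3) r], and [s] contributes [(1/3) p]. *)
  replace (- qP (aP dh b c t) (b t) (c t)) with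
    (2/3 * (rP (b t) (aP dh b c t) (c t) + rP (c t) (aP dh b c t) (b t))
     + 1/3 * pP (aP dh b c t) (b t) (c t))
    by (unfold rP, pP, qP; field).
  generalize (rP (b t) (aP dh b c t) (c t)) (rP (c t) (aP dh b c t) (b t))
    (pP (aP dh b c t) (b t) (c t)); intros r1 r2 p.
  unfold aP. field. lra.
Qed.

Lemma ln_g1_deriv (dh : R) (b c s : R -> R) (t : R) :
  0 < dh -> P_solution dh None b c -> conformal_factor dh b c s -> 0 <= t ->
  derivable_pt_lim (fun t => ln (aP dh b c t / s t)) t
    (- qP (aP dh b c t) (b t) (c t)).
Proof.
  intros Hd HP Hs Ht.
  assert (Hg := g1_deriv dh b c s t HP Hs Ht).
  destruct (HP t (in_dom_None t Ht)) as (Hb0 & Hc0 & _).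
  destruct (Hs t Ht) as (Hs0 & _).
  assert (Hpos : 0 < aP dh b c t / s t)
    by (apply Rdiv_lt_0_compat; [apply aP_pos |]; assumption).
  replace (- qP (aP dh b c t) (b t) (c t)) with
    (/ (aP dh b c t / s t) * (- qP (aP dh b c t) (b t) (c t) * (aP dh b c t / s t)))
    by (field; split; apply Rgt_not_eq; [exact Hs0 | now apply aP_pos]).
  apply (derivable_pt_lim_comp (fun t => aP dh b c t / s t) ln); [exact Hg |].
  now apply derivable_pt_lim_ln.
Qed.

Lemma P_asymptotics (dh : R) (b c s : R -> R) :
  0 < dh -> P_solution dh None b c -> b 0 <= c 0 ->
  to_infty_at None b -> to_infty_at None c -> conformal_factor dh b c s ->
  tends_to s 0 /\ tends_to (fun t => aP dh b c t / s t) 0 /\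
  tends_to (fun t => (c t - b t) / s t) 0.
Proof.
  intros Hd HP H0 Hb Hc Hs.
  destruct (P_eventually_elongated dh None b c) as (t0 & [Ht0 _] & He); auto.
  assert (Hgap : forall t, t0 <= t -> ln (b t) <= lyapunovP b c t).
  { intros t Ht. unfold lyapunovP.
    destruct (He t Ht (in_dom_None t ltac:(lra))) as ((_ & _ & H & _) & _). lra. }
  assert (Hdrift : forall t, t0 <= t -> exists v,
    derivable_pt_lim (lyapunovP b c) t v /\ 0 <= c t^3 * (c t - b t) /\
    v <= 2/3 * ((aP dh b c t)^2 * b t^2) - 90 * (c t^3 * (c t - b t))).
  { intros t Ht.
    assert (Hdt := in_dom_None t ltac:(lra)).
    destruct (He t Ht Hdt) as (Het & _).
    destruct (lyapunovP_deriv dh None b c t HP Hdt Het) as (v & Hv & Hle).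
    exists v; repeat split; auto. destruct Het as (Ha & Hba & Hbc & Hc1).
    apply Rmult_le_pos; [apply pow_le |]; lra. }
  split; [| split].
  (* With weight [1/4] the [a^2 b^2] terms cancel exactly: [- (1/3) p] gives at most [- 1/6] and the
     drift [(1/4)(2/3)]. *)
  - apply (tends_to_0_of_ln s b (1/4) (ln (s t0) + 1/4 * lyapunovP b c t0) t0);
      auto; [lra |].
    intros t Ht. split; [apply Hs; lra |].
    apply Rle_trans with (ln (s t) + 1/4 * lyapunovP b c t).
    { specialize (Hgap t Ht); lra. }
    apply (nonincreasing_of_deriv (fun t => ln (s t) + 1/4 * lyapunovP b c t));
      [exact Ht |].
    intros u [Hu _]. destruct (Hdrift u Hu) as (v & Hv & Hw & Hle).
    destruct (Hs u ltac:(lra)) as (Hs0 & Hs1).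
    exists (- (1/3) * pP (aP dh b c u) (b u) (c u) + 1/4 * v); split.
    + apply is_derive_Reals in Hv, Hs1. differentiate. field; lra.
    + destruct (He u Hu (in_dom_None u ltac:(lra))) as (Heu & _).
      assert (Hp := pP_ge _ _ _ Heu). lra.
  (* With weight [1/2] the [a^2 b^2] terms sum to at most [- 2/5 + 1/3 < 0], and those in
     [c^3 (c - b)] to at most [20 - 45 < 0]. *)
  - apply (tends_to_0_of_ln (fun t => aP dh b c t / s t) b (1/2)
      (ln (aP dh b c t0 / s t0) + 1/2 * lyapunovP b c t0) t0); auto; [lra |].
    intros t Ht. split.
    { destruct (HP t (in_dom_None t ltac:(lra))) as (Hb0 & Hc0 & _).
      apply Rdiv_lt_0_compat; [now apply aP_pos | apply Hs; lra]. }
    apply Rle_trans with (ln (aP dh b c t / s t) + 1/2 * lyapunovP b c t).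
    { specialize (Hgap t Ht); lra. }
    apply (nonincreasing_of_deriv
      (fun t => ln (aP dh b c t / s t) + 1/2 * lyapunovP b c t)); [exact Ht |].
    intros u [Hu _]. destruct (Hdrift u Hu) as (v & Hv & Hw & Hle).
    exists (- qP (aP dh b c u) (b u) (c u) + 1/2 * v); split.
    + apply (derivable_pt_lim_plus (fun t => ln (aP dh b c t / s t))
        (fun t => 1/2 * lyapunovP b c t)).
      * apply ln_g1_deriv; auto; lra.
      * now apply (derivable_pt_lim_scal (lyapunovP b c)).
    + destruct (He u Hu (in_dom_None u ltac:(lra))) as (Heu & _).
      assert (Hq := qP_ge _ _ _ Heu).
      assert (0 <= (aP dh b c u)^2 * b u^2)
        by (rewrite <- Rpow_mult_distr; apply pow2_ge_0).
      lra.
  (* The logarithmic rate of [(c - b) / s * exp t] is at most [1 - (16/3) c^4 + (8/3) c^4], negative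
     as [c >= 1]. *)
  - apply (tends_to_0_of_exp _ ((c t0 - b t0) / s t0 * exp t0) t0).
    intros t Ht. split.
    { destruct (He t Ht (in_dom_None t ltac:(lra))) as ((_ & _ & H & _) & _).
      destruct (Hs t ltac:(lra)) as (Hs0 & _).
      apply Rmult_le_pos; [lra | left; now apply Rinv_0_lt_compat]. }
    apply (nonincreasing_of_deriv (fun t => (c t - b t) / s t * exp t));
      [exact Ht |].
    intros u [Hu _]. assert (Hdu := in_dom_None u ltac:(lra)).
    destruct (He u Hu Hdu) as (Heu & _).
    destruct (Hs u ltac:(lra)) as (Hs0 & Hs1).
    assert (Hg := P_gap_deriv dh None b c u HP Hdu).
    exists ((1 - 2/3 * kappaP (aP dh b c u) (b u) (c u)
             + 1/3 * pP (aP dh b c u) (b u) (c u))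
            * ((c u - b u) / s u * exp u)); split.
    + set (w := fun t => c t - b t) in *.
      apply is_derive_Reals in Hg, Hs1.
      change (fun t => (c t - b t) / s t * exp t) with (fun t => w t / s t * exp t).
      change (c u - b u) with (w u) in *.
      differentiate; [lra |]. field; lra.
    + assert (Hp := pP_le _ _ _ Heu). assert (Hk := kappaP_ge _ _ _ Heu).
      destruct Heu as (_ & _ & Hbc & Hc1).
      assert (1 <= c u^4) by (apply pow_R1_Rle; exact Hc1).
      assert (0 <= (c u - b u) / s u * exp u).
      { apply Rmult_le_pos; [| left; apply exp_pos].
        apply Rmult_le_pos; [lra | left; now apply Rinv_0_lt_compat]. }
      nra.
Qed.

(** * Construction of the conformal factor and of the time change *)

Lemma conformal_factor_exists (dh s0 : R) (b c : R -> R) :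
  0 < s0 -> P_solution dh None b c ->
  exists s, s 0 = s0 /\ conformal_factor dh b c s.
Proof.
  intros Hs0 HP.
  (* The equation is linear in [s], so [s] is an exponential of a primitive of [p]. Nothing is known
     of [b] and [c] at negative times, so [Rmax 0 t] freezes the integrand there. *)
  destruct (primitive_exists
    (fun t => pP (aP dh b c (Rmax 0 t)) (b (Rmax 0 t)) (c (Rmax 0 t)))) as (I & HI0 & HI).
  { apply (continuity_comp_range (fun t => pP (aP dh b c t) (b t) (c t)) (Rmax 0));
      [apply Rmax_continuity |].
    intros t. generalize (Rmax 0 t) (Rmax_l 0 t); clear t; intros t Ht.
    destruct (HP t (in_dom_None t Ht)) as (Hb0 & Hc0 & Hb & Hc).
    apply is_derive_Reals in Hb, Hc.
    apply continuity_pt_filterlim.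
    apply (ex_derive_continuous (fun t => pP (aP dh b c t) (b t) (c t)) t).
    unfold pP, aP. auto_derive.
    repeat split; try (eexists; eassumption); apply Rgt_not_eq; nra. }
  exists (fun t => s0 * exp (- (1/3) * I t)); split.
  { rewrite HI0, Rmult_0_r, exp_0; ring. }
  intros t Ht; split.
  - apply Rmult_lt_0_compat; [exact Hs0 | apply exp_pos].
  - assert (HIt := HI t). cbv beta in HIt. rewrite (Rmax_right 0 t) in HIt by exact Ht.
    apply is_derive_Reals in HIt. differentiate. ring.
Qed.

Lemma conformal_factor_le (dh : R) (b c s : R -> R) (t : R) :
  conformal_factor dh b c s -> 0 <= t -> s t <= s 0.
Proof.
  intros Hs Ht. apply (nonincreasing_of_deriv s 0 t Ht).
  intros u Hu. destruct (Hs u (proj1 Hu)) as (Hu0 & Hu1).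
  eexists; split; [exact Hu1 |].
  assert (Hp := pP_nonneg (aP dh b c u) (b u) (c u)). nra.
Qed.

(** [psi] sends the time of (S3) to that of (P). It inverts [phi], the primitive of
    [1 / (beta s^2)], whose slope is at least [1 / (beta s(0)^2)] because [s] is nonincreasing. *)
Lemma time_change_exists (dh beta : R) (b c s : R -> R) :
  0 < beta -> conformal_factor dh b c s ->
  exists psi : R -> R, psi 0 = 0 /\ to_infty_at None psi /\
    forall u, 0 <= u ->
      0 <= psi u /\ derivable_pt_lim psi u (beta * s (psi u)^2).
Proof.
  intros Hbeta Hs.
  set (rate := fun t => / (beta * s (Rmax 0 t)^2)).
  assert (Hpos : forall t, 0 < beta * s (Rmax 0 t)^2).
  { intros t. apply Rmult_lt_0_compat; [exact Hbeta |].
    apply pow_lt, (Hs (Rmax 0 t)), Rmax_l. }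
  destruct (primitive_exists rate) as (phi & Hphi0 & Hphi).
  { apply continuity_inv; [| intros t; specialize (Hpos t); lra].
    apply (continuity_comp_range (fun t => beta * s t^2) (Rmax 0));
      [apply Rmax_continuity |].
    intros t. destruct (Hs (Rmax 0 t) (Rmax_l 0 t)) as (_ & Hd).
    apply is_derive_Reals in Hd.
    apply continuity_pt_filterlim.
    apply (ex_derive_continuous (fun t => beta * s t^2)). auto_derive.
    repeat split; eexists; eassumption. }
  destruct (Hs 0 (Rle_refl 0)) as (Hs0 & _).
  destruct (inverse_exists phi rate (/ (beta * s 0^2)))
    as (psi & _ & Hinv & Hmono & Hpsi); auto.
  { apply Rinv_0_lt_compat, Rmult_lt_0_compat; [exact Hbeta |].
    now apply pow_lt. }
  { intros t. apply Rinv_le_contravar; [apply Hpos |].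
    apply Rmult_le_compat_l; [lra |]. apply pow_incr; split.
    - left; apply (Hs (Rmax 0 t)), Rmax_l.
    - apply (conformal_factor_le dh b c s); [exact Hs | apply Rmax_l]. }
  assert (Hpsi0 : psi 0 = 0) by (rewrite <- Hphi0 at 1; apply Hinv).
  exists psi; split; [exact Hpsi0 |]; split.
  (* [psi] is known only to be nondecreasing; aiming at [M + 1] gives the strict inequality. *)
  - intros M. exists (Rmax 0 (phi (M + 1))); split.
    { apply in_dom_None, Rmax_l. }
    intros u Hu _. apply Rlt_le_trans with (M + 1); [lra |].
    rewrite <- (Hinv (M + 1)). apply Hmono.
    eapply Rle_trans, Hu. apply Rmax_r.
  - intros u Hu.
    assert (Hpu : 0 <= psi u) by (rewrite <- Hpsi0; now apply Hmono).
    split; [exact Hpu |].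
    specialize (Hpsi u). unfold rate in Hpsi.
    rewrite Rinv_inv, Rmax_right in Hpsi by exact Hpu. exact Hpsi.
Qed.

(** * From the planar system back to (S3) *)

(** Homogeneity of degree 4; the factor [s^2] split off is the one in the speed [beta s^2] of the
    time change. *)
Lemma pP_scale (x y z s : R) : s <> 0 ->
  pP (x / s) (y / s) (z / s) * (s^3)^3 = pP x y z * s^3 * s^2.
Proof. intros Hs; unfold pP; field; exact Hs. Qed.

Lemma qP_scale (x y z s : R) : s <> 0 ->
  qP (x / s) (y / s) (z / s) * (s^3)^2 = qP x y z * s^2.
Proof. intros Hs; unfold qP; field; exact Hs. Qed.

Lemma S3_of_P (h0 h1 h2 h3 : R) (b c s psi : R -> R) :
  0 < h0 -> 0 < h1 -> 0 < h2 -> 0 < h3 ->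
  s 0 = Rpower h0 (1/3) -> b 0 = s 0 * h2 -> c 0 = s 0 * h3 ->
  P_solution (deth h0 h1 h2 h3) None b c ->
  conformal_factor (deth h0 h1 h2 h3) b c s ->
  psi 0 = 0 ->
  (forall u, 0 <= u -> 0 <= psi u /\
     derivable_pt_lim psi u (betaC h0 h1 h2 h3 * s (psi u)^2)) ->
  S3_global_solution h0 h1 h2 h3
    (fun u => s (psi u)^3)
    (fun u => aP (deth h0 h1 h2 h3) b c (psi u) / s (psi u))
    (fun u => b (psi u) / s (psi u))
    (fun u => c (psi u) / s (psi u)).
Proof.
  intros Hh0 Hh1 Hh2 Hh3 Es Eb Ec HP Hs Hpsi0 Hpsi.
  assert (Hd : 0 < deth h0 h1 h2 h3)
    by (unfold deth; repeat apply Rmult_lt_0_compat; assumption).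
  assert (Hs0 : 0 < s 0) by (rewrite Es; apply exp_pos).
  assert (Es3 : s 0^3 = h0).
  { rewrite Es, <- Rpower_pow by apply exp_pos.
    rewrite Rpower_mult. replace (1/3 * INR 3) with 1 by (simpl; lra).
    now apply Rpower_1. }
  (* With [h0] written as [s(0)^3], the initial conditions become rational identities in [s(0)]. *)
  rewrite <- Es3 in *.
  unfold S3_global_solution; rewrite Hpsi0.
  split; [reflexivity |].
  split; [unfold aP, deth; rewrite Eb, Ec; field; lra |].
  split; [rewrite Eb; field; lra |].
  split; [rewrite Ec; field; lra |].
  intros u Hu. destruct (Hpsi u Hu) as (Ht & Hpu).
  rewrite Es3 in *. clear Es3.
  set (dh := deth h0 h1 h2 h3) in *. set (beta := betaC h0 h1 h2 h3) in *.
  assert (Hcomp : forall f v l,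
    derivable_pt_lim f (psi u) v -> v * (beta * s (psi u)^2) = l ->
    derivable_pt_lim (fun u => f (psi u)) u l).
  { intros f v l Hf <-. apply (derivable_pt_lim_comp psi f); assumption. }
  set (t := psi u) in *.
  destruct (HP t (in_dom_None t Ht)) as (Hb0 & Hc0 & Hb & Hc).
  destruct (Hs t Ht) as (Hst & Hs1).
  fold (aP dh b c t) in Hb, Hc.
  assert (Ha := aP_pos dh b c t Hd Hb0 Hc0).
  apply is_derive_Reals in Hb, Hc, Hs1.
  split; [| split; [| split]].
  - apply (Hcomp (fun t => s t^3)
      (- pP (aP dh b c t) (b t) (c t) * s t^3)).
    + differentiate. field.
    + assert (E := pP_scale (aP dh b c t) (b t) (c t) (s t) ltac:(lra)).
      transitivity (- beta * (pP (aP dh b c t) (b t) (c t) * s t^3 * s t^2)); [ring |].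
      rewrite <- E. ring.
  - apply (Hcomp (fun t => aP dh b c t / s t)
      (- qP (aP dh b c t) (b t) (c t) * (aP dh b c t / s t))).
    + now apply g1_deriv.
    + assert (E := qP_scale (aP dh b c t) (b t) (c t) (s t) ltac:(lra)).
      transitivity (- beta * (qP (aP dh b c t) (b t) (c t) * s t^2)
        * (aP dh b c t / s t)); [ring |].
      rewrite <- E. ring.
  - apply (Hcomp (fun t => b t / s t)
      (- qP (b t) (c t) (aP dh b c t) * (b t / s t))).
    + differentiate; [lra |].
      (* This is [r = (p + 3 q) / 2], using that [p] is symmetric and [q] is symmetric in its last
         two arguments. *)
      replace (- qP (b t) (c t) (aP dh b c t)) with
        (- (2/3) * rP (b t) (aP dh b c t) (c t) + 1/3 * pP (aP dh b c t) (b t) (c t))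
        by (unfold rP, pP, qP; field).
      field. lra.
    + assert (E := qP_scale (b t) (c t) (aP dh b c t) (s t) ltac:(lra)).
      transitivity (- beta * (qP (b t) (c t) (aP dh b c t) * s t^2)
        * (b t / s t)); [ring |].
      rewrite <- E. ring.
  - apply (Hcomp (fun t => c t / s t)
      (- qP (c t) (aP dh b c t) (b t) * (c t / s t))).
    + differentiate; [lra |].
      replace (- qP (c t) (aP dh b c t) (b t)) with
        (- (2/3) * rP (c t) (aP dh b c t) (b t) + 1/3 * pP (aP dh b c t) (b t) (c t))
        by (unfold rP, pP, qP; field).
      field. lra.
    + assert (E := qP_scale (c t) (aP dh b c t) (b t) (s t) ltac:(lra)).
      transitivity (- beta * (qP (c t) (aP dh b c t) (b t) * s t^2)
        * (c t / s t)); [ring |].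
      rewrite <- E. ring.
Qed.

(** * Transfer of limits through the time change, and conclusion *)

Lemma tends_to_reparam (f g psi : R -> R) (l : R) :
  to_infty_at None psi -> (forall u, 0 <= u -> g u = f (psi u)) ->
  tends_to f l -> tends_to g l.
Proof.
  intros Hpsi Hg Hf eps Heps.
  destruct (Hf eps Heps) as (T & HT).
  destruct (Hpsi T) as (u0 & [Hu0 _] & Hu).
  exists u0; intros u Huu.
  rewrite Hg by lra. apply HT, Rlt_le, Hu; [exact Huu |].
  apply in_dom_None; lra.
Qed.

Lemma to_infty_reparam (f g psi : R -> R) :
  to_infty_at None psi -> (forall u, 0 <= u -> g u = f (psi u)) ->
  to_infty_at None f -> tends_to_infty g.
Proof.
  intros Hpsi Hg Hf M.
  destruct (Hf M) as (T & [HT0 _] & HT).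
  destruct (Hpsi T) as (u0 & [Hu0 _] & Hu).
  exists u0; split; [now apply in_dom_None |].
  intros u Huu Hdu. destruct Hdu as [Hu1 _].
  assert (HTu : T < psi u) by (apply Hu; [exact Huu | now apply in_dom_None]).
  rewrite Hg by exact Hu1. apply HT; [lra | apply in_dom_None; lra].
Qed.

Lemma to_infty_div_factor (dh : R) (b c s f : R -> R) :
  conformal_factor dh b c s -> to_infty_at None f ->
  to_infty_at None (fun t => f t / s t).
Proof.
  intros Hs Hf M.
  destruct (Hs 0 (Rle_refl 0)) as (Hs0 & _).
  (* As [s t <= s 0], this threshold dominates [M * s t] for either sign of [M]. *)
  destruct (Hf (Rabs M * s 0)) as (t0 & Ht0 & Ht).
  exists t0; split; [exact Ht0 |]. intros t Htt Hdt.
  specialize (Ht t Htt Hdt). destruct Hdt as [Hdt _].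
  destruct (Hs t Hdt) as (Hst & _).
  assert (Hle := conformal_factor_le dh b c s t Hs Hdt).
  apply (Rmult_lt_reg_r (s t)); [exact Hst |].
  replace (f t / s t * s t) with (f t) by (field; lra).
  assert (HM := Rle_abs M). assert (HM' := Rabs_pos M). nra.
Qed.

Lemma tends_to_0_pow3 (f : R -> R) : tends_to f 0 -> tends_to (fun t => f t^3) 0.
Proof.
  intros Hf eps Heps.
  destruct (Hf (Rmin 1 eps)) as (T & HT); [apply Rmin_glb_lt; lra |].
  exists T; intros t Ht. specialize (HT t Ht).
  rewrite Rminus_0_r in *. rewrite <- RPow_abs.
  assert (H1 := Rmin_l 1 eps). assert (H2 := Rmin_r 1 eps).
  assert (H3 := Rabs_pos (f t)).
  assert (0 <= Rabs (f t)^2 <= 1) by nra.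
  simpl in *. nra.
Qed.

Theorem theorem5p21 (h0 h1 h2 h3 : R) :
  0 < h0 -> 0 < h1 -> 0 < h2 -> 0 < h3 ->
  h1 <= h2 -> h2 <= h3 ->
  in_D_infty h0 h1 h2 h3 ->
  (exists g0 g1 g2 g3 : R -> R, S3_global_solution h0 h1 h2 h3 g0 g1 g2 g3) /\
  (forall g0 g1 g2 g3 : R -> R, S3_global_solution h0 h1 h2 h3 g0 g1 g2 g3 ->
     tends_to g0 0 /\ tends_to g1 0 /\
     tends_to_infty g2 /\ tends_to_infty g3 /\
     tends_to (fun t => g3 t - g2 t) 0).
Proof.
  intros Hh0 Hh1 Hh2 Hh3 _ H23 (T & b & c & Eb & Ec & HP & Hb & Hc).
  assert (Hd : 0 < deth h0 h1 h2 h3)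
    by (unfold deth; repeat apply Rmult_lt_0_compat; assumption).
  assert (Hbeta : 0 < betaC h0 h1 h2 h3).
  { apply Rdiv_lt_0_compat; [lra |].
    apply Rmult_lt_0_compat; [lra | now apply pow_lt]. }
  assert (Hr : 0 < Rpower h0 (1/3)) by apply exp_pos.
  assert (Hbc : b 0 <= c 0) by (rewrite Eb, Ec; apply Rmult_le_compat_l; lra).
  assert (HT := P_time_infinite _ T b c Hd HP Hbc Hb Hc). subst T.
  destruct (conformal_factor_exists _ _ b c Hr HP) as (s & Es & Hs).
  destruct (time_change_exists _ _ b c s Hbeta Hs) as (psi & Hpsi0 & Hpsi & Hdpsi).
  rewrite <- Es in Eb, Ec.
  assert (HS := S3_of_P h0 h1 h2 h3 b c s psi Hh0 Hh1 Hh2 Hh3 Es Eb Ec HP Hs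
    Hpsi0 Hdpsi).
  split; [eauto |].
  intros g0 g1 g2 g3 Hg.
  (* An arbitrary global solution agrees for [t >= 0] with the one built from (P), whose limits are
     read off in the time of (P). *)
  assert (E := S3_unique _ _ _ _ _ _ _ _ _ _ _ _ Hg HS).
  destruct (P_asymptotics _ b c s Hd HP Hbc Hb Hc Hs) as (A0 & A1 & A2).
  repeat split.
  - apply (tends_to_reparam (fun t => s t^3) g0 psi); auto.
    + intros u Hu; now apply E.
    + now apply tends_to_0_pow3.
  - apply (tends_to_reparam (fun t => aP (deth h0 h1 h2 h3) b c t / s t) g1 psi); auto.
    intros u Hu; now apply E.
  - apply (to_infty_reparam (fun t => b t / s t) g2 psi); auto.
    + intros u Hu; now apply E.
    + now apply (to_infty_div_factor (deth h0 h1 h2 h3) b c).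
  - apply (to_infty_reparam (fun t => c t / s t) g3 psi); auto.
    + intros u Hu; now apply E.
    + now apply (to_infty_div_factor (deth h0 h1 h2 h3) b c).
  - apply (tends_to_reparam (fun t => (c t - b t) / s t) _ psi); auto.
    intros u Hu. destruct (E u Hu) as (_ & _ & -> & ->).
    unfold Rdiv; ring.
Qed.
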